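(* Let $I\subseteq\mathbb{R}$ be an open interval and let $y:I\to\mathbb{R}$ be a three times differentiable function with $y'(x)>0$ for all $x\in I$. (1) If $y(x)\neq x$ for all $x\in I$, then for every constant $C_0\in\mathbb{R}$ the function $y$ satisfies $$y'' + 2\,\frac{y' + C_0\,(y')^{3/2} + (y')^2}{x-y}=0\quad\text{on } I$$ if and only if $$\frac{(y-x)\,y''-2y'(1+y')}{2\,(y')^{3/2}}=C_0\quad\text{on } I.$$ (2) The following identity holds on $I$: $$\frac{d}{dx}\left(\frac{(y-x)\,y''-2y'(1+y')}{2\,(y')^{3/2}}\right)=\frac{y-x}{2\sqrt{y'}}\left(\frac{y'''}{y'}-\frac32\left(\frac{y''}{y'}\right)^2\right).$$ Consequently, the expression $\dfrac{(y-x)y''-2y'(1+y')}{2(y')^{3/2}}$ is a first integral of the Schwarz equation $\dfrac{y'''}{y'}-\dfrac32\left(\dfrac{y''}{y'}\right)^2=0$, with multiplier $\dfrac{y-x}{2\sqrt{y'}}$.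
   Context: Here $y=y(x)$ and primes denote derivatives with respect to $x$. A first integral of an ODE $F(x,y,y',y'',y''')=0$ with multiplier $\Lambda(x,y,y')$ is an expression $\Psi(x,y,y',y'')$ such that $\frac{d}{dx}\Psi=\Lambda F$ identically for all admissible functions $y(x)$; in particular $\Psi$ is constant along every solution of $F=0$. *)

(* Defs.v *)
From Stdlib Require Import Reals.
From Coquelicot Require Import Coquelicot.
Open Scope R_scope.

(** The endpoints may be infinite; the interval is nonempty. *)
Definition is_open_interval (I : R -> Prop) : Prop :=
  exists a b : Rbar, Rbar_lt a b /\
    forall x : R, I x <-> (Rbar_lt a x /\ Rbar_lt x b).

(** A function on an open interval [I] is represented by a total function of
    which only the values on [I] matter: since [I] is open, the derivatives at
    points of [I] do not depend on the values outside [I]. *)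
Definition three_times_differentiable_on (I : R -> Prop) (y : R -> R) : Prop :=
  forall x : R, I x -> forall k : nat, (k <= 3)%nat -> ex_derive_n y k x.

Definition admissible (I : R -> Prop) (y : R -> R) : Prop :=
  is_open_interval I /\ three_times_differentiable_on I y /\
  forall x : R, I x -> 0 < Derive_n y 1 x.

(** [y] is a solution on [I] of [F (x, y, y', y'', y''') = 0]. *)
Definition solution_on (F : R -> R -> R -> R -> R -> R)
    (I : R -> Prop) (y : R -> R) : Prop :=
  forall x : R, I x ->
    F x (y x) (Derive_n y 1 x) (Derive_n y 2 x) (Derive_n y 3 x) = 0.

(** [Psi (x, y, y', y'')] is a first integral of [F = 0] with multiplier
    [Lambda (x, y, y')], where [adm] is the class of admissible functions,
    each taken together with its interval. *)
Definition first_integral (adm : (R -> Prop) -> (R -> R) -> Prop)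
    (F : R -> R -> R -> R -> R -> R) (Lambda : R -> R -> R -> R)
    (Psi : R -> R -> R -> R -> R) : Prop :=
  forall (I : R -> Prop) (y : R -> R), adm I y ->
  forall x : R, I x ->
    is_derive (fun t : R => Psi t (y t) (Derive_n y 1 t) (Derive_n y 2 t)) x
      (Lambda x (y x) (Derive_n y 1 x) *
       F x (y x) (Derive_n y 1 x) (Derive_n y 2 x) (Derive_n y 3 x)).

(** Below, the arguments [u], [p], [q], [r] stand for [y], [y'], [y''], [y''']. *)

Definition schwarz (x u p q r : R) : R := r / p - 3 / 2 * (q / p) ^ 2.

Definition multiplier (x u p : R) : R := (u - x) / (2 * sqrt p).

Definition integral_expr (x u p q : R) : R :=
  ((u - x) * q - 2 * p * (1 + p)) / (2 * Rpower p (3 / 2)).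

(* Main.v *)
Require Import Defs.
From Stdlib Require Import Reals Lra.
From Coquelicot Require Import Coquelicot.
Open Scope R_scope.

(** Along a curve with u' = p > 0, p' = q, q' = r, the numerator
    N = (u - x) q - 2 p (1 + p) of the expression satisfies
    N' = (u - x) r - 3 q (1 + p), and differentiating the denominator
    2 p^(3/2) contributes - (3/2) (q / p) N to the numerator of the quotient's
    derivative.  The terms 3 q (1 + p) cancel, and what is left, divided by
    2 p^(3/2), is (u - x) / (2 sqrt p) times the Schwarz expression
    ([is_derive_integral_expr]).

    The equivalence needs no calculus: for u <> x both equations are the
    relation (u - x) q = 2 p (1 + p) + 2 C0 p^(3/2) among the values at one
    point ([ode_iff_integral_expr]).  Constancy of the expression along
    solutions follows from the derivative identity, because a function whose
    derivative vanishes on an interval is constant there. *)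

(** This makes the derivative identity one between rational functions of p,
    sqrt p and the other variables, which [field] can decide. *)
Lemma Rpower_3_2 (p : R) : 0 < p -> Rpower p (3 / 2) = p * sqrt p.
Proof.
  intros Hp.
  replace (3 / 2) with (1 + / 2) by field.
  now rewrite Rpower_plus, Rpower_1, Rpower_sqrt.
Qed.

Lemma ode_iff_integral_expr (x u p q C : R) :
  0 < p -> u <> x ->
  q + 2 * ((p + C * Rpower p (3 / 2) + p ^ 2) / (x - u)) = 0 <->
  integral_expr x u p q = C.
Proof.
  intros Hp Hux; unfold integral_expr.
  assert (HP : 0 < Rpower p (3 / 2)) by apply exp_pos.
  set (P := Rpower p (3 / 2)) in *; clearbody P.
  (* Each equation is the other one times a nonzero factor. *)
  assert (E : ((u - x) * q - 2 * p * (1 + p)) / (2 * P) - C =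
              (u - x) / (2 * P) * (q + 2 * ((p + C * P + p ^ 2) / (x - u))))
    by (field; split; lra).
  split; intros H.
  - rewrite H in E; lra.
  - rewrite H, Rminus_diag in E; symmetry in E.
    apply Rmult_integral in E as [E | E]; [exfalso | exact E].
    apply Rmult_integral in E as [E | E]; [lra |].
    revert E; apply Rinv_neq_0_compat; lra.
Qed.

Lemma is_derive_integral_expr (u p q : R -> R) (x r : R) :
  0 < p x ->
  is_derive u x (p x) -> is_derive p x (q x) -> is_derive q x r ->
  is_derive (fun t => integral_expr t (u t) (p t) (q t)) x
    (multiplier x (u x) (p x) * schwarz x (u x) (p x) (q x) r).
Proof.
  intros Hp Du Dp Dq.
  unfold integral_expr, multiplier, schwarz, Rpower.
  assert (HE : exp (3 / 2 * ln (p x)) = p x * sqrt (p x))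
    by exact (Rpower_3_2 _ Hp).
  assert (Hs : 0 < sqrt (p x)) by now apply sqrt_lt_R0.
  auto_derive.
  - repeat split; try (eexists; eassumption); try assumption.
    apply Rmult_integral_contrapositive_currified; [lra | apply Rgt_not_eq, exp_pos].
  - rewrite (is_derive_unique (fun t : R => u t) _ _ Du),
      (is_derive_unique (fun t : R => p t) _ _ Dp),
      (is_derive_unique (fun t : R => q t) _ _ Dq).
    rewrite HE; field; lra.
Qed.

Lemma is_derive_Derive_n (I : R -> Prop) (y : R -> R) (x : R) (k : nat) :
  three_times_differentiable_on I y -> I x -> (k < 3)%nat ->
  is_derive (Derive_n y k) x (Derive_n y (S k) x).
Proof. intros Hy Hx Hk; apply Derive_correct, (Hy x Hx (S k) Hk). Qed.

Lemma first_integral_schwarz :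
  first_integral admissible schwarz multiplier integral_expr.
Proof.
  intros I y (_ & Hy & Hpos) x Hx.
  apply is_derive_integral_expr; [now apply Hpos | | |].
  - apply (is_derive_Derive_n I y x 0); auto with arith.
  - apply (is_derive_Derive_n I y x 1); auto with arith.
  - apply (is_derive_Derive_n I y x 2); auto with arith.
Qed.

Lemma is_open_interval_inhabited (I : R -> Prop) :
  is_open_interval I -> exists x, I x.
Proof.
  intros (a & b & Hab & HI).
  destruct a as [a | |], b as [b | |]; simpl in Hab; try contradiction;
    [exists ((a + b) / 2) | exists (a + 1) | exists (b - 1) | exists 0];
    apply HI; simpl; lra.
Qed.

Lemma is_open_interval_convex (I : R -> Prop) (x y t : R) :
  is_open_interval I -> I x -> I y -> x <= t <= y -> I t.
Proof.
  intros (a & b & _ & HI) Hx Hy [Hxt Hty]; apply HI.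
  apply HI in Hx as [Hx _]; apply HI in Hy as [_ Hy]; split.
  - exact (Rbar_lt_le_trans a x t Hx Hxt).
  - exact (Rbar_le_lt_trans t y b Hty Hy).
Qed.

Lemma is_derive_0_constant (I : R -> Prop) (f : R -> R) :
  is_open_interval I -> (forall x, I x -> is_derive f x 0) ->
  exists c, forall x, I x -> f x = c.
Proof.
  intros HI Hf.
  destruct (is_open_interval_inhabited I HI) as [x0 Hx0].
  exists (f x0); intros x Hx.
  destruct (Rtotal_order x x0) as [Hlt | [-> | Hlt]]; [| reflexivity | symmetry];
    apply (eq_is_derive f); try assumption; intros t Ht; apply Hf.
  - exact (is_open_interval_convex I x x0 t HI Hx Hx0 Ht).
  - exact (is_open_interval_convex I x0 x t HI Hx0 Hx Ht).
Qed.

(** A first integral is constant along solutions whatever the equation and the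
    multiplier: on a solution its derivative is the multiplier times 0. *)
Lemma first_integral_constant (F : R -> R -> R -> R -> R -> R)
    (Lambda : R -> R -> R -> R) (Psi : R -> R -> R -> R -> R)
    (I : R -> Prop) (y : R -> R) :
  first_integral admissible F Lambda Psi ->
  admissible I y -> solution_on F I y ->
  exists c, forall x, I x -> Psi x (y x) (Derive_n y 1 x) (Derive_n y 2 x) = c.
Proof.
  intros HPsi Hadm Hsol.
  apply (is_derive_0_constant I
           (fun t => Psi t (y t) (Derive_n y 1 t) (Derive_n y 2 t)));
    [apply Hadm |].
  intros x Hx.
  rewrite <- (Rmult_0_r (Lambda x (y x) (Derive_n y 1 x))), <- (Hsol x Hx).
  now apply (HPsi I y).
Qed.

Theorem mainTheorem1 :
  (forall (I : R -> Prop) (y : R -> R),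
     is_open_interval I ->
     three_times_differentiable_on I y ->
     (forall x : R, I x -> 0 < Derive_n y 1 x) ->
     ((forall x : R, I x -> y x <> x) ->
      forall C0 : R,
        (forall x : R, I x ->
           Derive_n y 2 x +
           2 * ((Derive_n y 1 x + C0 * Rpower (Derive_n y 1 x) (3 / 2)
                 + (Derive_n y 1 x) ^ 2) / (x - y x)) = 0)
        <->
        (forall x : R, I x ->
           ((y x - x) * Derive_n y 2 x
            - 2 * Derive_n y 1 x * (1 + Derive_n y 1 x))
           / (2 * Rpower (Derive_n y 1 x) (3 / 2)) = C0))
     /\
     (forall x : R, I x ->
        is_derive
          (fun t : R =>
             ((y t - t) * Derive_n y 2 t
              - 2 * Derive_n y 1 t * (1 + Derive_n y 1 t))
             / (2 * Rpower (Derive_n y 1 t) (3 / 2)))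
          x
          ((y x - x) / (2 * sqrt (Derive_n y 1 x)) *
           (Derive_n y 3 x / Derive_n y 1 x
            - 3 / 2 * (Derive_n y 2 x / Derive_n y 1 x) ^ 2))))
  /\ first_integral admissible schwarz multiplier integral_expr
  /\ (forall (I : R -> Prop) (y : R -> R),
        admissible I y -> solution_on schwarz I y ->
        exists c : R, forall x : R, I x ->
          integral_expr x (y x) (Derive_n y 1 x) (Derive_n y 2 x) = c).
Proof.
  split; [| split].
  - intros I y HI Hy Hpos; split.
    + intros Hne C0; split; intros H x Hx;
        apply (ode_iff_integral_expr x (y x)); auto; now apply H.
    + exact (first_integral_schwarz I y (conj HI (conj Hy Hpos))).
  - exact first_integral_schwarz.
  - intros I y; apply first_integral_constant with (1 := first_integral_schwarz).
Qed.
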